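(* Let $p$ be a prime and $m\ge1$ an integer such that $3\mid p^m-1$. The characteristic functions $f_{\mathcal A_0}(\mathbf X)$, $f_{\mathcal A_1}(\mathbf X)$ and $f_{\mathcal A_2}(\mathbf X)$ are roots of a cubic equation $$y^3-\sigma_1y^2+\sigma_2y-\sigma_3=0\bmod \mathfrak I_{\mathbf X},$$ where $$\sigma_1=\Phi(\mathbf X)-1\bmod \mathfrak I_{\mathbf X},$$ $$\sigma_2=\frac13(p^m-1)(\Phi(\mathbf X)-1)\bmod \mathfrak I_{\mathbf X},$$ $$\sigma_3=\frac1{27}\left[(\Phi(\mathbf X)-1)^3+\left(3-3\Phi(\mathbf X)+J(\chi_3,\chi_3)+\bar J(\chi_3,\chi_3)\right)\left(p^m-\Phi(\mathbf X)\right)\right]\bmod \mathfrak I_{\mathbf X}.$$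
   Context: $\mathbb F_{p^m}$ is the finite field with $p^m$ elements, with basis $\{1,\eta,\dots,\eta^{m-1}\}$ over $\mathbb F_p$, where $\eta$ is a root of an irreducible polynomial of degree $m$ over $\mathbb F_p$. $\alpha$ is a fixed primitive element of $\mathbb F_{p^m}$ and $\omega\in\mathbb C$ a primitive cube root of unity. $\mathcal A_0$ is the subgroup of nonzero cubes in $\mathbb F_{p^m}^*$, $\mathcal A_1=\alpha\mathcal A_0$, $\mathcal A_2=\alpha^2\mathcal A_0$. $\chi_3$ is the cubic character given by $\chi_3(\alpha^h\theta)=\omega^h$ for $\theta\in\mathcal A_0$, $h=0,1,2$, and $\chi_3(0)=0$. $J(\chi_3,\chi_3)=\sum_{c_1,c_2\in\mathbb F_{p^m},\,c_1+c_2=1}\chi_3(c_1)\chi_3(c_2)$ is the Jacobi sum and $\bar J(\chi_3,\chi_3)$ its complex conjugate (the sum $J(\chi_3,\chi_3)+\bar J(\chi_3,\chi_3)$ is an integer). $\mathbf X=(x_0,\dots,x_{m-1})$ are indeterminates. For $\gamma=\gamma_0+\gamma_1\eta+\cdots+\gamma_{m-1}\eta^{m-1}\in\mathbb F_{p^m}$ with $\gamma_k\in\mathbb F_p$ identified with its representative in $\{0,\dots,p-1\}$, $\mathbf X^\gamma$ denotes the monomial $x_0^{\gamma_0}x_1^{\gamma_1}\cdots x_{m-1}^{\gamma_{m-1}}$. The characteristic function of $\mathcal A_j$ is $f_{\mathcal A_j}(\mathbf X)=\sum_{\gamma\in\mathcal A_j}\mathbf X^\gamma$, $j=0,1,2$.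 $\mathfrak I_{\mathbf X}$ is the ideal of $\mathbb Q[\mathbf X]$ generated by $x_0^p-1,\dots,x_{m-1}^p-1$; all equalities modulo $\mathfrak I_{\mathbf X}$ are in $\mathbb Q[\mathbf X]/\mathfrak I_{\mathbf X}$. $\Phi(\mathbf X)=\prod_{k=0}^{m-1}\Phi_p(x_k)$, where $\Phi_p(x)=1+x+\cdots+x^{p-1}$ is the $p$-th cyclotomic polynomial. *)

(* Defs.v *)
From HB Require Import structures.
From mathcomp Require Import all_boot all_order all_algebra all_field.
From mathcomp Require Import mpoly.

Set Implicit Arguments.
Unset Strict Implicit.
Unset Printing Implicit Defensive.

Import GRing.Theory Num.Theory.
Local Open Scope ring_scope.

Section CubicCyclotomy.
Variables (F : finFieldType) (alpha : F).

Definition cubes : {set F} := [set y ^+ 3 | y : F & y != 0].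
Definition cubic_coset (h : nat) : {set F} :=
  [set alpha ^+ h * theta | theta in cubes].

(* For alpha primitive and 3 %| #|F| - 1 the three cosets partition F \ {0}:
   the index picked is then unique, and the default case is x = 0. *)
Definition chi3 (C : nzRingType) (omega : C) (x : F) : C :=
  if [pick h : 'I_3 | x \in cubic_coset h] is Some h then omega ^+ h else 0.

End CubicCyclotomy.

Definition jacobi_sum (F : finFieldType) (C : nzRingType) (chi psi : F -> C) : C :=
  \sum_(c : F * F | c.1 + c.2 == 1) chi c.1 * psi c.2.

Section CharacteristicFunction.
Variables (p m : nat) (L : fieldExtType 'F_p) (eta : L).

Definition power_basis : m.-tuple L := [tuple eta ^+ k | k < m].

(* The exponent of x_k is the k-th coordinate of gamma, an element of 'F_p read
   as a natural number through the coercion from ordinals; for p prime this is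
   the representative in {0, ..., p - 1}. *)
Definition mono (gamma : L) : {mpoly rat[m]} :=
  'X_[[multinom (coord power_basis k gamma : nat) | k < m]].

Definition charfun (A : {set finvect_type L}) : {mpoly rat[m]} :=
  \sum_(gamma in A) mono gamma.

End CharacteristicFunction.

Definition Phi (p m : nat) : {mpoly rat[m]} :=
  \prod_(k < m) \sum_(i < p) 'X_k ^+ i.

(* Equality in the quotient of Q[X] by the ideal generated by the x_k^p - 1. *)
Definition eq_modI (p m : nat) (P Q : {mpoly rat[m]}) : Prop :=
  exists c : 'I_m -> {mpoly rat[m]}, P - Q = \sum_(k < m) c k * ('X_k ^+ p - 1).

(* Main.v *)
(** Sending x_k to the group element [eta^k] identifies Q[X] modulo the ideal
    with the group ring Q[F] of the additive group of F = F_{p^m}, and the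
    identity can be checked in C[F].  There, put g = sum_x chi(x) [x] and let g'
    be its conjugate.  Directly from the definition of the product,
      g^2 = J g',   g'^2 = J^* g,   g g' = p^m - Phi,   Phi^2 = p^m Phi,
    without evaluating at additive characters.  With w = omega^j and
    s = Phi - 1, orthogonality of the cubic characters gives
    3 f_j = s + w^2 g + w g', whence
      (3 f_j - s)^3 = (p^m - Phi) (J + J^* + 3 (3 f_j - s)),
    which is 27 times the cubic equation once expanded. *)

Require Import Defs.
From HB Require Import structures.
From mathcomp Require Import all_boot all_order all_algebra all_field.
From mathcomp Require Import mpoly ring.

Set Implicit Arguments.
Unset Strict Implicit.
Unset Printing Implicit Defensive.

Import GRing.Theory Num.Theory.
Local Open Scope ring_scope.

(* An alias of [{ffun G -> R}]: the multiplication is convolution instead of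
   the pointwise product. *)
Definition group_ring (G : finZmodType) (R : comNzRingType) : Type :=
  {ffun G -> R}.

(** * The group ring of a finite abelian group, with convolution as product *)

Section GroupRing.
Variables (G : finZmodType) (R : comNzRingType).
Implicit Types (a b c : group_ring G R) (x y z : G).

HB.instance Definition _ := GRing.Zmodule.on (group_ring G R).

Definition gr_single x : group_ring G R := [ffun y => (y == x)%:R].

Definition gr_mul a b : group_ring G R :=
  [ffun x => \sum_y (a : {ffun G -> R}) y * (b : {ffun G -> R}) (x - y)].

Lemma gr_mulC : commutative gr_mul.
Proof.
move=> a b; apply/ffunP => x; rewrite !ffunE.
rewrite (reindex_inj (inv_inj (subKr x))) /=.
by apply: eq_bigr => y _; rewrite subKr mulrC.
Qed.

Lemma gr_mulA : associative gr_mul.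
Proof.
move=> a b c; apply/ffunP => x; rewrite !ffunE.
under eq_bigr do rewrite ffunE mulr_sumr.
under [RHS]eq_bigr do rewrite ffunE mulr_suml.
rewrite [RHS]exchange_big /=; apply: eq_bigr => y _.
rewrite [RHS](reindex_inj (addIr y)) /=; apply: eq_bigr => z _.
by rewrite addrK mulrA opprD addrA addrAC.
Qed.

Lemma gr_mul1r : left_id (gr_single 0) gr_mul.
Proof.
move=> a; apply/ffunP => x; rewrite ffunE (bigD1 0) //= ffunE eqxx mul1r subr0.
by rewrite big1 ?addr0 // => y y0; rewrite ffunE (negPf y0) mul0r.
Qed.

Lemma gr_mulDl : left_distributive gr_mul +%R.
Proof.
move=> a b c; apply/ffunP => x; rewrite !ffunE -big_split /=.
by apply: eq_bigr => y _; rewrite ffunE mulrDl.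
Qed.

Lemma gr_oner_neq0 : gr_single 0 != 0.
Proof. by apply/eqP => /ffunP /(_ 0) /eqP; rewrite !ffunE eqxx oner_eq0. Qed.

HB.instance Definition _ := GRing.Zmodule_isComNzRing.Build (group_ring G R)
  gr_mulA gr_mulC gr_mul1r gr_mulDl gr_oner_neq0.

Definition gr_coef a x : R := (a : {ffun G -> R}) x.

Definition gr_fun (f : G -> R) : group_ring G R := finfun f.

Lemma gr_coefP a b : gr_coef a =1 gr_coef b -> a = b.
Proof. by move=> ab; apply/ffunP. Qed.

Lemma gr_coef_fun f x : gr_coef (gr_fun f) x = f x.
Proof. exact: ffunE. Qed.

Lemma gr_coefD a b x : gr_coef (a + b) x = gr_coef a x + gr_coef b x.
Proof. exact: ffunE. Qed.

Lemma gr_coefN a x : gr_coef (- a) x = - gr_coef a x.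
Proof. exact: ffunE. Qed.

Lemma gr_coef0 x : gr_coef 0 x = 0.
Proof. exact: ffunE. Qed.

Lemma gr_coefM a b x :
  gr_coef (a * b) x = \sum_y gr_coef a y * gr_coef b (x - y).
Proof. exact: ffunE. Qed.

Lemma gr_coef_single x y : gr_coef (gr_single x) y = (y == x)%:R.
Proof. exact: ffunE. Qed.

Lemma gr_coef_sum I (r : seq I) (Q : pred I) (F : I -> group_ring G R) x :
  gr_coef (\sum_(i <- r | Q i) F i) x = \sum_(i <- r | Q i) gr_coef (F i) x.
Proof.
apply: (big_morph (gr_coef^~ x)) => [a b|]; first exact: gr_coefD.
exact: gr_coef0.
Qed.

Lemma gr_coef_single_mul z a x :
  gr_coef (gr_single z * a) x = gr_coef a (x - z).
Proof.
rewrite gr_coefM (bigD1 z) //= gr_coef_single eqxx mul1r big1 ?addr0 // => y yz.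
by rewrite gr_coef_single (negPf yz) mul0r.
Qed.

Lemma gr_single0 : gr_single 0 = 1.
Proof. by []. Qed.

Lemma gr_coef1 x : gr_coef 1 x = (x == 0)%:R.
Proof. by rewrite -gr_single0 gr_coef_single. Qed.

Lemma gr_singleD x y : gr_single (x + y) = gr_single x * gr_single y.
Proof.
apply: gr_coefP => z; rewrite gr_coef_single_mul !gr_coef_single.
by rewrite subr_eq (addrC x).
Qed.

Lemma gr_singleMn x n : gr_single (x *+ n) = gr_single x ^+ n.
Proof.
elim: n => [|n IH]; first by rewrite mulr0n.
by rewrite mulrS exprS gr_singleD IH.
Qed.

Lemma gr_single_sum I (r : seq I) (Q : pred I) (F : I -> G) :
  gr_single (\sum_(i <- r | Q i) F i) = \prod_(i <- r | Q i) gr_single (F i).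
Proof. exact: (big_morph gr_single gr_singleD gr_single0). Qed.

(** The scalars [k] as multiples of the unit [[0]]. Scaling thus becomes a ring product, and [ring]
    can handle scalars such as [J] and [omega ^+ j]. *)
Definition gr_const (k : R) : group_ring G R := gr_fun (fun x => k *+ (x == 0)).

Lemma gr_coef_constM k a x : gr_coef (gr_const k * a) x = k * gr_coef a x.
Proof.
rewrite gr_coefM (bigD1 0) //= gr_coef_fun eqxx mulr1n subr0 big1 ?addr0 //.
by move=> y y0; rewrite gr_coef_fun (negPf y0) mulr0n mul0r.
Qed.

Lemma gr_coef_const k x : gr_coef (gr_const k) x = k *+ (x == 0).
Proof. exact: gr_coef_fun. Qed.

Fact gr_const_is_zmod_morphism : zmod_morphism gr_const.
Proof.
move=> k l; apply: gr_coefP => x.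
by rewrite gr_coefD gr_coefN !gr_coef_const mulrnBl.
Qed.

Fact gr_const_is_monoid_morphism : monoid_morphism gr_const.
Proof.
split=> [|k l]; apply: gr_coefP => x; first by rewrite gr_coef_const.
by rewrite gr_coef_constM !gr_coef_const mulrnAr.
Qed.

HB.instance Definition _ := GRing.isZmodMorphism.Build R (group_ring G R)
  gr_const gr_const_is_zmod_morphism.
HB.instance Definition _ := GRing.isMonoidMorphism.Build R (group_ring G R)
  gr_const gr_const_is_monoid_morphism.

End GroupRing.

Arguments gr_const {G R} k.
Arguments gr_single {G} R x.

(** * Congruence modulo the ideal of the $x_k^p-1$ *)

Section ModI.
Variables (p m : nat).
Local Notation pol := {mpoly rat[m]}.
Local Notation "P ~ Q" := (eq_modI p P Q) (at level 70).
Implicit Types P Q : pol.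

Lemma eq_modI_refl P : P ~ P.
Proof. by exists (fun=> 0); rewrite subrr big1 // => k _; rewrite mul0r. Qed.

Lemma eq_modI_trans P Q S : P ~ Q -> Q ~ S -> P ~ S.
Proof.
move=> [c Ec] [d Ed]; exists (fun k => c k + d k).
rewrite -(subrKA Q) Ec Ed -big_split /=.
by apply: eq_bigr => k _; rewrite mulrDl.
Qed.

Lemma eq_modIMl P Q S : Q ~ S -> P * Q ~ P * S.
Proof.
move=> [c Ec]; exists (fun k => P * c k).
by rewrite -mulrBr Ec mulr_sumr; apply: eq_bigr => k _; rewrite mulrA.
Qed.

Lemma eq_modID P Q P' Q' : P ~ P' -> Q ~ Q' -> P + Q ~ P' + Q'.
Proof.
move=> [c Ec] [d Ed]; exists (fun k => c k + d k).
rewrite opprD addrACA Ec Ed -big_split /=.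
by apply: eq_bigr => k _; rewrite mulrDl.
Qed.

Lemma eq_modIM P Q P' Q' : P ~ P' -> Q ~ Q' -> P * Q ~ P' * Q'.
Proof.
move=> EP EQ; apply: eq_modI_trans (eq_modIMl P' EQ).
by rewrite ![_ * Q]mulrC; apply: eq_modIMl.
Qed.

Lemma eq_modI_Xp (k : 'I_m) : 'X_k ^+ p ~ 1.
Proof.
exists (fun i => (i == k)%:R); rewrite (bigD1 k) //= eqxx mul1r big1 ?addr0 //.
by move=> i /negPf ->; rewrite mul0r.
Qed.

Lemma eq_modI_Xmod (k : 'I_m) n : 'X_k ^+ n ~ 'X_k ^+ (n %% p).
Proof.
rewrite {1}(divn_eq n p) exprD mulnC exprM -[X in _ ~ X]mul1r.
apply: eq_modIM; last exact: eq_modI_refl.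
elim: (n %/ p)%N => [|i IH]; first by rewrite expr0; apply: eq_modI_refl.
by rewrite exprS -[X in _ ~ X]mulr1; apply: eq_modIM IH; apply: eq_modI_Xp.
Qed.

Lemma eq_modI_sum I (r : seq I) (F H : I -> pol) :
  (forall i, F i ~ H i) -> \sum_(i <- r) F i ~ \sum_(i <- r) H i.
Proof.
move=> FH; elim/big_ind2: _ => //; first exact: eq_modI_refl.
by move=> *; apply: eq_modID.
Qed.

Lemma eq_modI_prod I (r : seq I) (F H : I -> pol) :
  (forall i, F i ~ H i) -> \prod_(i <- r) F i ~ \prod_(i <- r) H i.
Proof.
move=> FH; elim/big_ind2: _ => //; first exact: eq_modI_refl.
by move=> *; apply: eq_modIM.
Qed.

End ModI.

(** * The powers of $\eta$ as an $\mathbb F_p$-basis *)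

Section PowerBasis.
Variables (p m : nat) (p_prime : prime p) (L : fieldExtType 'F_p).
Hypothesis card_L : #|finvect_type L| = (p ^ m)%N.
Variables (P : {poly 'F_p}) (P_irr : irreducible_poly P).
Hypothesis P_deg : size P = m.+1.
Variables (eta : L) (P_eta : root (map_poly (in_alg L) P) eta).

Lemma power_basisE (k : 'I_m) : (power_basis m eta)`_k = eta ^+ k.
Proof. by rewrite nth_mktuple. Qed.

(** A vanishing combination is a polynomial [Q] of degree below $m$ with root [eta]. If nonzero, it
    would be coprime to the irreducible [P] of degree $m$, yet share the root [eta] with it. *)
Lemma power_basis_free : free (power_basis m eta).
Proof.
(* [oapp c 0 (insub k)] extends [c] from ['I_m] to all naturals; the default 0 is never reached for
   [k < m]. *)
apply/freeP => c sum0 i; pose Q := \poly_(k < m) oapp c 0 (insub k).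
have Q0 : Q = 0.
  apply/eqP/negPn/negP => nzQ.
  have copPQ : coprimep P Q.
    rewrite irreducible_poly_coprime //; apply/negP => /(dvdp_leq nzQ).
    by rewrite P_deg ltnNge size_poly.
  rewrite -(coprimep_map (in_alg L)) in copPQ.
  case/negP: (coprimep_root copPQ P_eta).
  rewrite (@horner_coef_wide _ m) ?size_map_poly ?size_poly //.
  rewrite -[X in _ == X]sum0.
  apply/eqP/eq_bigr => k _.
  rewrite coef_map coef_poly ltn_ord valK /= power_basisE.
  by rewrite mulr_algl.
by have /polyP/(_ i) := Q0; rewrite coef_poly ltn_ord valK coef0.
Qed.

Lemma power_basis_basis : basis_of fullv (power_basis m eta).
Proof.
rewrite basisEfree power_basis_free subvf size_tuple /=.
have p_gt1 : (1 < p)%N by apply: prime_gt1.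
(* The dimension is read off from the cardinality: $p^{\dim L}=p^m$. *)
have := card_vspace (fullv : {vspace finvect_type L}).
rewrite card_vspacef card_L card_Fp // => /(expnI p_gt1) m_eq.
by rewrite m_eq.
Qed.

End PowerBasis.

(** * Polynomials modulo the ideal, seen inside the group ring over [C] *)

Section Evaluation.
Variables (p m : nat) (p_prime : prime p) (L : fieldExtType 'F_p) (eta : L).
Hypothesis eta_basis : basis_of fullv (power_basis m eta).
Variable C : numFieldType.
Local Notation G := (finvect_type L).

(** The field element whose group-ring basis vector is the image of the monomial [mon]. *)
Definition expt_class (mon : 'X_{1..m}) : G := \sum_(k < m) (eta ^+ k) *+ mon k.

Definition gr_eval : {mpoly rat[m]} -> group_ring G C :=
  mmap (gr_const \o ratr) (fun k => gr_single C (eta ^+ k : G)).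

HB.instance Definition _ := GRing.RMorphism.on gr_eval.

Lemma gr_evalX k : gr_eval 'X_k = gr_single C (eta ^+ k : G).
Proof. by rewrite /gr_eval mmapX mmap1U. Qed.

Lemma gr_evalXm mon : gr_eval 'X_[mon] = gr_single C (expt_class mon).
Proof.
rewrite mpolyXE_id rmorph_prod gr_single_sum; apply: eq_bigr => k _.
by rewrite rmorphXn /= gr_evalX gr_singleMn.
Qed.

Lemma expt_class_coord (gamma : L) :
  expt_class [multinom (coord (power_basis m eta) k gamma : nat) | k < m]
  = gamma.
Proof.
rewrite [RHS](coord_basis eta_basis) ?memvf //; apply: eq_bigr => k _.
by rewrite mnmE power_basisE -scaler_nat natr_Zp.
Qed.

Lemma gr_eval_mono (gamma : L) :
  gr_eval (mono m eta gamma) = gr_single C (gamma : G).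
Proof. by rewrite gr_evalXm expt_class_coord. Qed.

Lemma gr_evalZ (a : rat) Q : gr_eval (a *: Q) = gr_const (ratr a) * gr_eval Q.
Proof. by rewrite -mul_mpolyC rmorphM /= /gr_eval mmapC. Qed.

Lemma coord_expt_class mon (k : 'I_m) :
  (coord (power_basis m eta) k (expt_class mon) : nat) = (mon k %% p)%N.
Proof.
have -> : expt_class mon =
    \sum_(i < m) ((mon i)%:R : 'F_p) *: (power_basis m eta)`_i.
  by apply: eq_bigr => i _; rewrite power_basisE scaler_nat.
by rewrite coord_sum_free ?(basis_free eta_basis) // val_Fp_nat.
Qed.

Lemma eq_modI_Xm mon : eq_modI p 'X_[mon] (mono m eta (expt_class mon)).
Proof.
rewrite /mono !mpolyXE_id; apply: eq_modI_prod => k.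
by rewrite mnmE coord_expt_class; apply: eq_modI_Xmod.
Qed.

(** Each monomial is congruent to the reduced monomial of its class, so the coefficients can be
    collected class by class. *)
Lemma eq_modI_normal_form (Q : {mpoly rat[m]}) :
  exists h : G -> rat, eq_modI p Q (\sum_x h x *: mono m eta x).
Proof.
exists (fun x => \sum_(mon <- msupp Q | expt_class mon == x) Q@_mon).
under eq_bigr do rewrite scaler_suml.
rewrite (exchange_big_dep predT) //= {1}(mpolyE Q).
apply: eq_modI_sum => mon; rewrite (big_pred1 (expt_class mon)); last first.
  by move=> x; rewrite eq_sym.
rewrite -!mul_mpolyC; apply: eq_modIMl; exact: eq_modI_Xm.
Qed.

Lemma gr_eval_sum_mono (h : G -> rat) :
  gr_eval (\sum_x h x *: mono m eta x) = gr_fun (fun x => ratr (h x)).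
Proof.
apply: gr_coefP => y; rewrite gr_coef_fun rmorph_sum gr_coef_sum (bigD1 y) //=.
rewrite big1 => [|x xy]; rewrite gr_evalZ gr_coef_constM gr_eval_mono.
  by rewrite gr_coef_single eqxx mulr1 addr0.
by rewrite gr_coef_single eq_sym (negPf xy) mulr0.
Qed.

(** The generators vanish because $p\,\eta^k=0$ in characteristic $p$, so that
    $[\eta^k]^p=[0]=1$. *)
Lemma gr_eval_eq_modI P Q : eq_modI p P Q -> gr_eval P = gr_eval Q.
Proof.
move=> [c Ec]; apply/eqP; rewrite -subr_eq0 -rmorphB Ec rmorph_sum.
rewrite big1 //= => k _.
rewrite rmorphM rmorphB rmorphXn rmorph1 /= gr_evalX -gr_singleMn -scaler_nat.
by rewrite pchar_Fp_0 // scale0r gr_single0 subrr mulr0.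
Qed.

(** For the converse, the normal form of [P - Q] evaluates to the function [ratr (h x)]; this is
    zero, and $\mathbb Q\to C$ is injective, so [h] is zero. *)
Lemma eq_modI_gr_eval P Q : eq_modI p P Q <-> gr_eval P = gr_eval Q.
Proof.
split=> [|PQ]; first exact: gr_eval_eq_modI.
have [h Eh] := eq_modI_normal_form (P - Q).
suff h0 : forall x, h x = 0.
  case: Eh => c; rewrite big1 ?subr0 => [|x _]; last by rewrite h0 scale0r.
  by exists c.
move=> x; have /(congr1 (@gr_coef _ _ ^~ x)) := gr_eval_eq_modI Eh.
rewrite rmorphB /= PQ subrr gr_coef0 gr_eval_sum_mono gr_coef_fun => /esym/eqP.
by rewrite fmorph_eq0 => /eqP.
Qed.

Lemma gr_eval_charfun (A : {set finvect_type L}) :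
  gr_eval (charfun m eta A) = gr_fun (fun x => (x \in A)%:R).
Proof.
apply: gr_coefP => y; rewrite gr_coef_fun rmorph_sum gr_coef_sum /=.
under eq_bigr do rewrite gr_eval_mono gr_coef_single.
have [yA|yA] := boolP (y \in A).
  rewrite (bigD1 y) //= eqxx big1 ?addr0 // => x /andP[_ xy].
  by rewrite eq_sym (negPf xy).
by apply: big1 => x xA; case: eqP yA => // ->; rewrite xA.
Qed.

(** Expanding the product selects one exponent in $\{0,\dots,p-1\}$ for each variable, that is, a
    coordinate vector over $\mathbb F_p$; these vectors are in bijection with the field. *)
Lemma Phi_sum_mono : Phi p m = \sum_(x : G) mono m eta x.
Proof.
pose vec (c : {ffun 'I_m -> 'F_p}) : G :=
  \sum_k c k *: (power_basis m eta)`_k.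
pose crd (x : G) := [ffun k => coord (power_basis m eta) k x].
have vecK : cancel vec crd.
  move=> c; apply/ffunP => k.
  by rewrite ffunE coord_sum_free ?(basis_free eta_basis).
have crdK : cancel crd vec.
  move=> x; rewrite [RHS](coord_basis eta_basis) ?memvf //.
  by apply: eq_bigr => k _; rewrite ffunE.
rewrite (reindex vec); last by exists crd => x _; rewrite ?vecK ?crdK.
transitivity (\prod_(k < m) \sum_(c : 'F_p) ('X_k : {mpoly rat[m]}) ^+ c).
  apply: eq_bigr => k _.
  by rewrite -[LHS](big_mkord xpredT) -{1}(Fp_cast p_prime) big_mkord.
rewrite bigA_distr_bigA /=; apply: eq_bigr => c _.
rewrite /mono mpolyXE_id; apply: eq_bigr => k _.
by rewrite mnmE -[c in LHS]vecK ffunE.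
Qed.

Lemma gr_eval_Phi : gr_eval (Phi p m) = gr_fun (fun=> 1).
Proof.
rewrite Phi_sum_mono; under eq_bigr do rewrite -[mono _ _ _]scale1r.
by rewrite (gr_eval_sum_mono (fun=> 1)) rmorph1.
Qed.

End Evaluation.

(** * The cubic character, its Jacobi sums and the group-ring identities *)

Section CubicCharacter.
Variables (F : finFieldType) (alpha : F).
Hypotheses (alpha_prim : (#|F|.-1).-primitive_root alpha).
Hypothesis dvd3 : (3 %| #|F|.-1)%N.
Variables (C : numClosedFieldType) (omega : C).
Hypothesis omega_prim : 3.-primitive_root omega.
Local Notation chi := (chi3 alpha omega).
Local Notation J := (jacobi_sum chi chi).

Lemma primitive_neq0 : alpha != 0.
Proof.
by rewrite (prim_root_eq0 alpha_prim) -lt0n (prim_order_gt0 alpha_prim).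
Qed.

Lemma primitive_log x : x != 0 -> exists i, x = alpha ^+ i.
Proof.
move=> x0; have x1 : x ^+ #|F|.-1 = 1.
  apply: (mulfI x0); rewrite -exprS prednK ?expf_card ?mulr1 //.
  by apply/card_gt0P; exists x.
by have [i ->] := prim_rootP alpha_prim x1; exists i.
Qed.

(** Exponents of [alpha] are determined modulo [#|F|.-1], hence modulo 3 since 3 divides it. *)
Lemma mem_cubic_coset i h :
  (alpha ^+ i \in cubic_coset alpha h) = (i == h %[mod 3]).
Proof.
apply/imsetP/idP => [[_ /imsetP[y /[!inE] y0 ->]]|ih].
  have [k ->] := primitive_log y0.
  rewrite -exprM -exprD => /eqP; rewrite (eq_prim_root_expr alpha_prim).
  move=> /eqP /(congr1 (modn^~ 3)); rewrite !modn_dvdm // => ->.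
  by rewrite -modnDmr modnMl addn0.
have n0 : (0 < #|F|.-1)%N := prim_order_gt0 alpha_prim.
(* Subtracting [h] from [i] could truncate. Adding [#|F|.-1 * h] first prevents this and changes
   neither the power of [alpha] nor the residue modulo 3. *)
have le_h : (h <= i + #|F|.-1 * h)%N.
  by rewrite (leq_trans (leq_pmull h n0)) ?leq_addl.
have dvd_h : (3 %| i + #|F|.-1 * h - h)%N.
  rewrite -eqn_mod_dvd // -(eqP ih).
  by rewrite -modnDmr (eqP (dvdn_mulr h dvd3)) addn0.
pose y := alpha ^+ ((i + #|F|.-1 * h - h) %/ 3); exists (y ^+ 3).
  by apply/imsetP; exists y; rewrite ?inE ?expf_neq0 ?primitive_neq0.
rewrite -exprM divnK // -exprD subnKC // exprD exprM.
by rewrite (prim_expr_order alpha_prim) expr1n mulr1.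
Qed.

Lemma cubic_coset_neq0 h : 0 \notin cubic_coset alpha h.
Proof.
apply/imsetP => -[_ /imsetP[y /[!inE] y0 ->]] /esym/eqP.
by rewrite mulf_eq0 !expf_eq0 (negPf primitive_neq0) (negPf y0) !andbF.
Qed.

Lemma chi3_0 : chi 0 = 0.
Proof.
by rewrite /chi3; case: pickP => // h; rewrite (negPf (cubic_coset_neq0 h)).
Qed.

Lemma chi3_exp i : chi (alpha ^+ i) = omega ^+ i.
Proof.
(* The index [i %% 3] always qualifies, which rules out the default case of [pick]. *)
rewrite /chi3; case: pickP => [h|/(_ (inord (i %% 3)))].
  rewrite mem_cubic_coset => /eqP ih; apply/eqP.
  by rewrite (eq_prim_root_expr omega_prim) ih.
by rewrite mem_cubic_coset inordK ?ltn_mod // modn_mod eqxx.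
Qed.

Lemma chi3_1 : chi 1 = 1.
Proof. exact: (chi3_exp 0). Qed.

Lemma chi3M : {morph chi : x y / x * y}.
Proof.
move=> x y; have [->|/primitive_log[i ->]] := eqVneq x 0.
  by rewrite mul0r chi3_0 mul0r.
have [->|/primitive_log[k ->]] := eqVneq y 0.
  by rewrite mulr0 chi3_0 mulr0.
by rewrite -exprD !chi3_exp exprD.
Qed.

Lemma chi3_cube x : x != 0 -> chi x ^+ 3 = 1.
Proof.
move=> /primitive_log[i ->].
by rewrite chi3_exp exprAC (prim_expr_order omega_prim) expr1n.
Qed.

Lemma chi3_neq0 x : x != 0 -> chi x != 0.
Proof.
move=> /chi3_cube x3; apply/eqP => x0.
by move/eqP: x3; rewrite x0 expr0n eq_sym oner_eq0.
Qed.

(** Off 0 the value is a cube root of unity, so it has modulus 1 and its conjugate is its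
    inverse. *)
Lemma conj_chi3 x : (chi x)^* = chi x ^+ 2.
Proof.
have [->|x0] := eqVneq x 0; first by rewrite chi3_0 conjC0 expr0n.
have x3 := chi3_cube x0; apply: (mulfI (chi3_neq0 x0)).
rewrite -exprS x3 -normCK.
have /eqP : `|chi x| ^+ 3 = 1 by rewrite -normrX x3 normr1.
by rewrite pexpr_eq1 // => /eqP ->; rewrite expr1n.
Qed.

Lemma chi3V x : chi x^-1 = (chi x)^*.
Proof.
have [->|x0] := eqVneq x 0; first by rewrite invr0 chi3_0 conjC0.
apply: (mulfI (chi3_neq0 x0)).
by rewrite -chi3M divff // chi3_1 conj_chi3 -exprS chi3_cube.
Qed.

(** Both the cube and the square of this value are 1. *)
Lemma chi3_N1 : chi (-1) = 1.
Proof.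
have := @chi3_cube (-1); rewrite oppr_eq0 oner_eq0 => /(_ isT).
by rewrite exprS expr2 -chi3M mulrNN mulr1 chi3_1 mulr1.
Qed.

Lemma chi3N x : chi (- x) = chi x.
Proof. by rewrite -mulN1r chi3M chi3_N1 mul1r. Qed.

Lemma omega_neq1 : omega != 1.
Proof. by rewrite -[omega]expr1 -(prim_order_dvd omega_prim). Qed.

(** Multiplication by [alpha] permutes the field and scales the sum by [omega], which is not 1. *)
Lemma sum_chi3 : \sum_x chi x = 0.
Proof.
have E : \sum_x chi x = omega * \sum_x chi x.
  rewrite {1}(reindex_inj (mulfI primitive_neq0)) mulr_sumr /=.
  by apply: eq_bigr => x _; rewrite chi3M (chi3_exp 1).
apply/eqP; move/eqP: E.
rewrite -subr_eq0 -{1}[\sum_x _]mul1r -mulrBl mulf_eq0 subr_eq0 eq_sym.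
by rewrite (negPf omega_neq1).
Qed.

Lemma jacobi_sumE : J = \sum_c chi c * chi (1 - c).
Proof.
pose h c : F * F := (c, 1 - c).
rewrite /jacobi_sum (reindex h) /=; last first.
  exists fst => // -[c d]; rewrite inE /= => cd; congr (_, _).
  by rewrite -(eqP cd) addrC addKr.
by apply: eq_bigl => c; rewrite addrC subrK eqxx.
Qed.

(** For $c\ne1$ the term is $\chi(c/(1-c))$, and $c/(1-c)=(1-c)^{-1}-1$ takes every value except
    $-1$. The sum is therefore $0-\chi(-1)$. *)
Lemma sum_chi3_conj_chi3 : \sum_c chi c * (chi (1 - c))^* = - 1.
Proof.
(* As the inverse of 0 is 0 here, this map is a permutation of the whole field and sends 1 to the
   missing value $-1$. *)
have inj : injective (fun c : F => (1 - c)^-1 - 1).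
  by move=> c d /addIr /invr_inj /addrI /oppr_inj.
apply/eqP; rewrite -subr_eq0 opprK -[X in _ == X]sum_chi3.
rewrite [X in _ == X](reindex_inj inj) /=.
rewrite (bigD1 1) //= [X in _ == X](bigD1 1) //=.
rewrite subrr chi3_0 conjC0 mulr0 add0r invr0 add0r chi3_N1 addrC.
apply/eqP; congr (_ + _); apply: eq_bigr => c c1; rewrite -chi3V -chi3M.
by congr chi3; field; rewrite subr_eq0 eq_sym.
Qed.

(** A Gauss sum before an additive character is applied. *)
Definition gauss_elt : group_ring F C := gr_fun chi.
Definition conj_gauss_elt : group_ring F C := gr_fun (fun x => (chi x)^*).

(** At $x\ne0$ the substitution $y=xc$ pulls out $\chi(x)^2=\overline{\chi(x)}$ and leaves $J$; at 0
    the coefficient is the conjugate of [sum_chi3]. *)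
Lemma gauss_elt_sqr : gauss_elt ^+ 2 = gr_const J * conj_gauss_elt.
Proof.
apply: gr_coefP => x; rewrite gr_coef_constM gr_coefM !gr_coef_fun.
under eq_bigr do rewrite !gr_coef_fun.
have [->|x0] := eqVneq x 0.
  transitivity (\sum_x chi x)^*; last by rewrite sum_chi3 chi3_0 conjC0 mulr0.
  rewrite rmorph_sum; apply: eq_bigr => y _.
  by rewrite sub0r chi3N /= conj_chi3 expr2.
rewrite (reindex_inj (mulfI x0)) jacobi_sumE mulr_suml /=.
apply: eq_bigr => c _; rewrite -{2}[x]mulr1 -mulrBr !chi3M conj_chi3; ring.
Qed.

Lemma conj_gauss_elt_sqr : conj_gauss_elt ^+ 2 = gr_const J^* * gauss_elt.
Proof.
apply: gr_coefP => x; have := congr1 ((@gr_coef _ _)^~ x) gauss_elt_sqr.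
rewrite !gr_coef_constM !gr_coefM !gr_coef_fun => /(congr1 Num.conj).
rewrite rmorphM /= conjCK rmorph_sum => <-.
by apply: eq_bigr => y _; rewrite !gr_coef_fun rmorphM.
Qed.

(** The coefficient at 0 counts the nonzero elements; elsewhere, scaling by $x$ reduces it to
    [sum_chi3_conj_chi3]. *)
Lemma gauss_elt_mul_conj :
  gauss_elt * conj_gauss_elt = #|F|%:R - gr_fun (fun=> 1).
Proof.
apply: gr_coefP => x.
rewrite -(rmorph_nat gr_const) gr_coefD gr_coefN gr_coef_const gr_coef_fun.
rewrite gr_coefM; under eq_bigr do rewrite !gr_coef_fun.
have [->|x0] := eqVneq x 0.
  rewrite (bigD1 0) //= chi3_0 mul0r add0r.
  rewrite (eq_bigr (fun=> 1)) => [|y y0]; last first.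
    by rewrite sub0r chi3N conj_chi3 -exprS chi3_cube.
  rewrite sumr_const cardC1 -subn1 natrB //.
  by apply/card_gt0P; exists 0.
rewrite mulr0n sub0r -sum_chi3_conj_chi3 (reindex_inj (mulfI x0)) /=.
apply: eq_bigr => c _; rewrite -{2}[x]mulr1 -mulrBr !chi3M rmorphM /=.
rewrite conj_chi3 mulrACA -exprS chi3_cube // mul1r //.
Qed.

Lemma cubic_coset_gauss j :
  gr_const 3%:R * gr_fun (fun x => (x \in cubic_coset alpha j)%:R) =
  gr_fun (fun=> 1) - 1 + gr_const (omega ^+ j) ^+ 2 * gauss_elt
    + gr_const (omega ^+ j) * conj_gauss_elt.
Proof.
apply: gr_coefP => x; rewrite -rmorphXn !gr_coefD gr_coefN gr_coef1.
rewrite !gr_coef_constM !gr_coef_fun.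
have [->|/primitive_log[i ->]] := eqVneq x 0.
  by rewrite (negPf (cubic_coset_neq0 j)) chi3_0 conjC0 !mulr0 subrr !addr0.
rewrite conj_chi3 chi3_exp mem_cubic_coset -(eq_prim_root_expr omega_prim).
rewrite subr0.
have cube n : (omega ^+ n) ^+ 3 = 1.
  by rewrite exprAC (prim_expr_order omega_prim) expr1n.
have nz n : omega ^+ n != 0.
  by rewrite expf_neq0 // (prim_root_eq0 omega_prim).
(* What remains concerns two cube roots of unity: $1+w^2z+wz^2$ is 3 if $z=w$ and 0 otherwise. *)
move: (omega ^+ j) (omega ^+ i) (nz i) (cube j) (cube i) => w z z0 w3 z3.
have [->|zw] := eqVneq z w; first by rewrite mulr1 -exprSr -exprS w3; ring.
rewrite mulr0; apply/esym; apply: (mulfI z0); apply: (mulfI (_ : z - w != 0)).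
  by rewrite subr_eq0.
transitivity (z * (z ^+ 3 - w ^+ 3)); last by rewrite z3 w3 subrr !mulr0.
ring: z3 w3.
Qed.

(** Each term is $z+z^2$ with $z$ zero or a cube root of unity, hence 0, 2 or $-1$. The integer lets
    $\sigma_3$ be written with rational coefficients. *)
Lemma jacobi_sum_add_conj_int : exists T : int, T%:~R = J + J^*.
Proof.
rewrite rmorph_sum -big_split /=.
apply: (big_ind (fun z : C => exists T : int, T%:~R = z)).
- by exists 0.
- by move=> _ _ [T <-] [U <-]; exists (T + U); rewrite intrD.
move=> c _; rewrite -chi3M conj_chi3.
have [->|/chi3_cube] := eqVneq (c.1 * c.2) 0.
  by exists 0; rewrite chi3_0 expr0n addr0.
set z := chi _ => z3; have [->|z1] := eqVneq z 1.
  by exists 2; rewrite expr1n.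
exists (-1); apply: (mulfI (_ : z - 1 != 0)); first by rewrite subr_eq0.
have -> : (z - 1) * (z + z ^+ 2) = z ^+ 3 - z by ring.
by rewrite z3; ring.
Qed.

(** The cubic equation multiplied by 27, which removes all denominators. *)
Lemma cubic_coset_root j (T : int) : T%:~R = J + J^* ->
  let q := #|F|%:R : group_ring F C in
  let phi := gr_fun (fun=> 1) : group_ring F C in
  let y := gr_fun (fun x => (x \in cubic_coset alpha j)%:R) : group_ring F C in
  27%:R * (y ^+ 3 - (phi - 1) * y ^+ 2) + 9%:R * ((q - 1) * (phi - 1)) * y
  = (phi - 1) ^+ 3 + (3%:R - 3%:R * phi + T%:~R) * (q - phi).
Proof.
move=> ET q phi y; set s := phi - 1; set D := q - phi.
pose w : group_ring F C := gr_const (omega ^+ j).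
(* Since $w^3=1$, the twisted elements [a] and [b] satisfy the same quadratic relations as $g$ and
   $g'$. *)
pose a := w ^+ 2 * gauss_elt; pose b := w * conj_gauss_elt.
have w3 : w ^+ 3 = 1.
  by rewrite -rmorphXn exprAC (prim_expr_order omega_prim) expr1n rmorph1.
have a2 : a ^+ 2 = gr_const J * b.
  by rewrite /a exprMn gauss_elt_sqr /b; ring: w3.
have b2 : b ^+ 2 = gr_const J^* * a.
  by rewrite /b exprMn conj_gauss_elt_sqr /a; ring.
have ab : a * b = D.
  by rewrite /D -gauss_elt_mul_conj /a /b; ring: w3.
have phi2 : phi ^+ 2 = q * phi.
  apply: gr_coefP => x; rewrite /q -(rmorph_nat gr_const) gr_coef_constM.
  rewrite expr2 gr_coefM.
  under eq_bigr do rewrite !gr_coef_fun mulr1.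
  by rewrite sumr_const gr_coef_fun mulr1.
have y3 : 3%:R * y = s + a + b.
  by rewrite -(rmorph_nat gr_const) cubic_coset_gauss.
have Tc : T%:~R = gr_const J + gr_const J^* :> group_ring F C.
  by rewrite -(rmorphD gr_const) /= -ET rmorph_int.
(* This turns the linear term into $9(s^2-D)y$, whose part $9s^2y$ completes the cube of $3y-s$. *)
have -> : (q - 1) * s = s ^+ 2 - D.
  by rewrite /s /D; ring: phi2.
have -> : 27%:R * (y ^+ 3 - s * y ^+ 2) + 9%:R * (s ^+ 2 - D) * y =
  (3%:R * y - s) ^+ 3 + s ^+ 3 - 3%:R * D * (3%:R * y) by ring.
have -> : 3%:R * y - s = a + b by rewrite y3; ring.
(* Here $a^3=J\,ab$, $b^3=\bar J\,ab$, and the mixed terms are $3ab(a+b)$. *)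
have -> : (a + b) ^+ 3 = D * (T%:~R + 3%:R * (a + b)).
  by rewrite -ab Tc; ring: a2 b2.
by rewrite y3 /s; ring.
Qed.

End CubicCharacter.

(** * Transfer of the identity back to polynomials *)

Theorem theorem5 (p m : nat) (p_prime : prime p) (m_ge1 : (1 <= m)%N)
    (dvd3 : (3 %| p ^ m - 1)%N)
    (L : fieldExtType 'F_p) (card_L : #|finvect_type L| = (p ^ m)%N)
    (P : {poly 'F_p}) (P_irr : irreducible_poly P) (P_deg : size P = m.+1)
    (eta : L) (P_eta : root (map_poly (in_alg L) P) eta)
    (alpha : finvect_type L) (alpha_prim : (p ^ m - 1).-primitive_root alpha)
    (C : numClosedFieldType) (omega : C) (omega_prim : 3.-primitive_root omega) :
  let f (j : 'I_3) : {mpoly rat[m]} := charfun m eta (cubic_coset alpha j) in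
  let chi : finvect_type L -> C := chi3 alpha omega in
  let J : C := jacobi_sum chi chi in
  exists T : int,
    T%:~R = J + J^* /\
    forall sigma1 sigma2 sigma3 : {mpoly rat[m]},
      eq_modI p sigma1 (Phi p m - 1) ->
      eq_modI p sigma2 ((3%:R^-1 * ((p ^ m)%:R - 1)) *: (Phi p m - 1)) ->
      eq_modI p sigma3
        (27%:R^-1 *: ((Phi p m - 1) ^+ 3 +
           (3%:R - 3%:R * Phi p m + T%:~R) * ((p ^ m)%:R - Phi p m))) ->
      forall j : 'I_3,
        eq_modI p (f j ^+ 3 - sigma1 * f j ^+ 2 + sigma2 * f j - sigma3) 0.
Proof.
move=> f chi J.
have alpha_prim' : (#|finvect_type L|.-1).-primitive_root alpha.
  by rewrite card_L -subn1.
have dvd3' : (3 %| #|finvect_type L|.-1)%N by rewrite card_L -subn1.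
have eta_basis := power_basis_basis p_prime card_L P_irr P_deg P_eta.
have [T ET] := jacobi_sum_add_conj_int alpha_prim' dvd3' omega_prim.
exists T; split=> // s1 s2 s3 E1 E2 E3 j.
pose ev := gr_eval eta C :
  {rmorphism {mpoly rat[m]} -> group_ring (finvect_type L) C}.
have evE Q R : eq_modI p Q R <-> ev Q = ev R by apply: eq_modI_gr_eval.
have evZ a Q : ev (a *: Q) = gr_const (ratr a) * ev Q by apply: gr_evalZ.
move/evE: E1 => E1; move/evE: E2 => E2; move/evE: E3 => E3; apply/evE.
have := cubic_coset_root alpha_prim' dvd3' omega_prim j ET.
have evPhi : ev (Phi p m) = gr_fun (fun=> 1) by apply: gr_eval_Phi.
have evf : ev (f j) = gr_fun (fun x => (x \in cubic_coset alpha j)%:R).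
  exact: gr_eval_charfun.
have evs1 : ev s1 = ev (Phi p m) - 1.
  by rewrite [LHS]E1 (rmorphB ev) rmorph1.
have evs2 : ev s2 =
    gr_const (ratr 3%:R^-1) * ((p ^ m)%:R - 1) * (ev (Phi p m) - 1).
  rewrite [LHS]E2 evZ (rmorphB ev) (rmorph1 ev).
  rewrite (rmorphM ratr) (rmorphB ratr) (rmorph1 ratr) (rmorph_nat ratr).
  rewrite (rmorphM gr_const) (rmorphB gr_const) (rmorph1 gr_const).
  by rewrite (rmorph_nat gr_const).
have evs3 : ev s3 = gr_const (ratr 27%:R^-1) * ((ev (Phi p m) - 1) ^+ 3 +
    (3%:R - 3%:R * ev (Phi p m) + T%:~R) * ((p ^ m)%:R - ev (Phi p m))).
  rewrite [LHS]E3 evZ (rmorphD ev) (rmorphXn ev).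
  rewrite (rmorphM ev) (rmorphB ev) (rmorph1 ev) (rmorphD ev) !(rmorphB ev).
  by rewrite (rmorphM ev) (rmorph_int ev) !(rmorph_nat ev).
rewrite card_L -evf -evPhi (rmorph0 ev).
rewrite (rmorphB ev) (rmorphD ev) (rmorphB ev) (rmorphXn ev) (rmorphM ev).
rewrite (rmorphXn ev) (rmorphM ev) evs1 evs2 evs3.
move: (ev (f j)) (ev (Phi p m)) => y phi R.
set t := gr_const (ratr 3%:R^-1); set u := gr_const (ratr 27%:R^-1).
have t3 : t * 3%:R = 1.
  rewrite -(rmorph_nat gr_const) -rmorphM -(ratr_nat C) -rmorphM.
  by rewrite mulVf ?rmorph1.
have u27 : u * 27%:R = 1.
  rewrite -(rmorph_nat gr_const) -rmorphM -(ratr_nat C) -rmorphM.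
  by rewrite mulVf ?rmorph1.
(* Writing 1/3 as 9/27 leaves [u] as the only inverse in the goal. *)
have <- : u * 9%:R = t.
  transitivity (u * 9%:R * (t * 3%:R)); first by rewrite t3 mulr1.
  by rewrite -[RHS]mulr1 -[X in _ = t * X]u27; ring.
(* With $27\sigma_3$ replaced by the left side of [R], the terms linear in [y] cancel. *)
rewrite -R; transitivity ((1 - u * 27%:R) * (y ^+ 3 - (phi - 1) * y ^+ 2)).
  by ring.
by rewrite u27 subrr mul0r.
Qed.
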